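(* Assume that $g$ and $\psi_{\ell-1}$, $\ell\in[L]$, are directionally differentiable everywhere on $\mathbb{R}^{\bar N_L}$ and $\mathbb{R}^{n+\bar N_{\ell-1}}$, $\ell\in[L]$, respectively, and locally Lipschitz continuous. Let the penalty parameters $\beta_\ell>0$, $\ell\in[L]$, satisfy $$\beta_\ell>K_g\prod_{j=\ell+1}^{L}(1+K_{j-1})\quad\text{for all }\ell\in[L],$$ where $K_g$ and $K_1,\dots,K_{L-1}$ are the Lipschitz constants described in the context. Then: (a) $\mathcal{S}_0=\mathcal{S}_1$; (b) for every $z\in\mathbb{R}^{\bar N}$ with $\Theta(z)\le\bar\gamma$, $z$ is a d-stationary point of (P0) (i.e. $z\in\mathcal{D}_0$) if and only if $z$ is a d-stationary point of (P1) (i.e. $z\in\mathcal{D}_1$).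
   Context: Let $n,L,N_1,\dots,N_L$ be positive integers, $[L]=\{1,\dots,L\}$, $\bar N_0=0$, $\bar N_\ell=\sum_{j=1}^{\ell}N_j$, $\bar N=n+\bar N_L$, $\lambda>0$. Let $g:\mathbb{R}^{\bar N_L}\to[0,\infty)$ and $\psi_{\ell-1}:\mathbb{R}^{n+\bar N_{\ell-1}}\to\mathbb{R}^{N_\ell}$ ($\ell\in[L]$) be continuous. Write $u=(u_1,\dots,u_L)$ with $u_\ell\in\mathbb{R}^{N_\ell}$, $\mathbf{u}_\ell=(u_1,\dots,u_\ell)$, $\mathbf{u}_0$ empty, $z=(\theta,u)\in\mathbb{R}^{\bar N}$ with $\theta\in\mathbb{R}^n$. $\|\cdot\|$ is the Euclidean norm. Empty products equal $1$. $F(z)=g(u)+\lambda\|\theta\|^2$; $\mathcal{F}_0=\{z\mid u_\ell=\psi_{\ell-1}(\theta,\mathbf{u}_{\ell-1}),\ \ell\in[L]\}$; $\Theta(z)=F(z)+\sum_{\ell=1}^{L}\beta_\ell\|u_\ell-\psi_{\ell-1}(\theta,\mathbf{u}_{\ell-1})\|_1$ with $\beta_\ell>0$. Problem (P0) is $\min_{z\in\mathcal{F}_0}F(z)$, with set of global minimizers $\mathcal{S}_0$; problem (P1) is $\min_{z\in\mathbb{R}^{\bar N}}\Theta(z)$, with set of global minimizers $\mathcal{S}_1$. Directional derivative: $f'(x;d)=\lim_{\tau\downarrow0}\frac{f(x+\tau d)-f(x)}{\tau}$ (componentwise for vector-valued $f$). Tangent cone: $\mathcal{T}_{\mathcal{F}}(x)=\{d\mid\exists\,x^k\to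 x,\ x^k\in\mathcal{F},\ \tau_k\downarrow0\text{ with }(x^k-x)/\tau_k\to d\}$. d-stationary points: $\mathcal{D}_0=\{z\in\mathcal{F}_0\mid F'(z;d)\ge0\ \forall d\in\mathcal{T}_{\mathcal{F}_0}(z)\}$ for (P0), $\mathcal{D}_1=\{z\in\mathbb{R}^{\bar N}\mid\Theta'(z;d)\ge0\ \forall d\in\mathbb{R}^{\bar N}\}$ for (P1). Level $\bar\gamma$: let $z^0=(\mathbf{0},u_1^0,\dots,u_L^0)$ with $u_\ell^0=\psi_{\ell-1}(\mathbf{0},u_1^0,\dots,u_{\ell-1}^0)$ for $\ell=1,\dots,L$, and $\bar\gamma=\Theta(z^0)=F(z^0)$. Let $lev_{\le\bar\gamma}\Theta=\{z\mid\Theta(z)\le\bar\gamma\}$ (a compact set). Lipschitz constants: $K_g>0$ and $K_\ell>0$ ($\ell\in[L-1]$) are constants such that for some (sufficiently small) $\epsilon>0$, $|g(u)-g(\bar u)|\le K_g\|u-\bar u\|$ and $\|\psi_{\ell-1}(\theta,\mathbf{u}_{\ell-1})-\psi_{\ell-1}(\theta,\bar{\mathbf{u}}_{\ell-1})\|\le K_{\ell-1}\|\mathbf{u}_{\ell-1}-\bar{\mathbf{u}}_{\ell-1}\|$ for $\ell=2,\dots,L$, for all $(\theta,u),(\theta,\bar u)\in lev_{\le\bar\gamma}\Theta+\epsilon\mathbb{B}$, where $\mathbb{B}$ is the closed unit ball of $\mathbb{R}^{\bar N}$. (Such constants exist under the stated local Lipschitz assumption.) *)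

(* Defs.v *)
From HB Require Import structures.
From mathcomp Require Import all_boot all_order all_algebra.
From mathcomp Require Import all_classical all_reals all_analysis.

Set Implicit Arguments.
Unset Strict Implicit.
Unset Printing Implicit Defensive.

Import Order.TTheory GRing.Theory Num.Theory.
Import numFieldNormedType.Exports.

Local Open Scope classical_set_scope.
Local Open Scope ring_scope.

(* The library norm `|x| on 'rV[R]_m is the sup norm.  It induces the usual
   topology of R^m, but quantitative statements need the two norms below. *)
Definition enorm (R : realType) (m : nat) (x : 'rV[R]_m) : R :=
  Num.sqrt (\sum_(i < m) x 0 i ^+ 2).

Definition l1norm (R : realType) (m : nat) (x : 'rV[R]_m) : R :=
  \sum_(i < m) `|x 0 i|.

Definition dir_quotient (R : realType) (V W : normedModType R)
    (f : V -> W) (x d : V) (t : R) : W :=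
  t^-1 *: (f (x + t *: d) - f x).

Definition dir_differentiable (R : realType) (V W : normedModType R)
    (f : V -> W) : Prop :=
  forall x d : V, cvg (dir_quotient f x d t @[t --> 0^'+]).

(* Meaningful only when the one-sided limit exists: [lim] is total. *)
Definition dir_deriv (R : realType) (V W : normedModType R)
    (f : V -> W) (x d : V) : W :=
  lim (dir_quotient f x d t @[t --> 0^'+]).

(* Every x has a neighbourhood on which f is Lipschitz; this does not depend
   on the choice of equivalent norms. *)
Definition locally_lipschitz (R : realType) (V W : normedModType R)
    (f : V -> W) : Prop :=
  forall x : V, lipschitz_on f (nbhs (x, x)).

Definition tangent_cone (R : realType) (V : normedModType R)
    (A : set V) (x : V) : set V :=
  [set d | exists (xs : nat -> V) (tau : nat -> R),
    [/\ forall k, A (xs k),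
        xs k @[k --> \oo] --> x,
        forall k, 0 < tau k,
        tau k @[k --> \oo] --> (0 : R)
      & (tau k)^-1 *: (xs k - x) @[k --> \oo] --> d]].

Definition minimizers (R : realType) (T : Type) (A : set T) (f : T -> R) :
    set T :=
  [set x | A x /\ forall y, A y -> f x <= f y].

(* Layers are indexed from 0, so N l is the dimension of the (l+1)-st layer
   u_(l+1), and [\sum_(j < l) N j] is that of the first l layers together;
   only the values N 0, ..., N (L - 1) matter.  The block of u with index
   l : 'I_L is [ublock u l], and [uprefix u l] consists of the blocks of index
   less than l. *)
Definition ublock (R : realType) (L : nat) (N : nat -> nat)
    (u : 'rV[R]_(\sum_(j < L) N j)) (l : 'I_L) : 'rV[R]_(N l) :=
  submxrow u l.

Definition uprefix (R : realType) (L : nat) (N : nat -> nat)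
    (u : 'rV[R]_(\sum_(j < L) N j)) (l : 'I_L) : 'rV[R]_(\sum_(j < l) N j) :=
  \mxrow_(j < l) (ublock u (widen_ord (ltnW (ltn_ord l)) j) : 'rV[R]_(N j)).

Section Problems.

Context (R : realType) (n L : nat) (N : nat -> nat).
Context (g : 'rV[R]_(\sum_(j < L) N j) -> R).
Context (psi : forall l : 'I_L, 'rV[R]_(n + \sum_(j < l) N j) -> 'rV[R]_(N l)).
Context (lambda : R) (beta : 'I_L -> R).

(* The theta part of z is [lsubmx z] and its u part is [rsubmx z]. *)
Definition objective (z : 'rV[R]_(n + \sum_(j < L) N j)) : R :=
  g (rsubmx z) + lambda * enorm (lsubmx z) ^+ 2.

Definition activation (theta : 'rV[R]_n) (u : 'rV[R]_(\sum_(j < L) N j))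
    (l : 'I_L) : 'rV[R]_(N l) :=
  @psi l (row_mx theta (uprefix u l)).

Definition feasible : set 'rV[R]_(n + \sum_(j < L) N j) :=
  [set z | forall l : 'I_L,
    ublock (rsubmx z) l = activation (lsubmx z) (rsubmx z) l].

Definition penalized (z : 'rV[R]_(n + \sum_(j < L) N j)) : R :=
  objective z +
  \sum_(l < L) beta l *
    l1norm (ublock (rsubmx z) l - activation (lsubmx z) (rsubmx z) l).

Definition dstat0 : set 'rV[R]_(n + \sum_(j < L) N j) :=
  [set z | feasible z /\
    forall d, tangent_cone feasible z d -> 0 <= dir_deriv objective z d].

Definition dstat1 : set 'rV[R]_(n + \sum_(j < L) N j) :=
  [set z | forall d, 0 <= dir_deriv penalized z d].

Definition level_set (gamma : R) : set 'rV[R]_(n + \sum_(j < L) N j) :=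
  [set z | penalized z <= gamma].

End Problems.

(* The Minkowski sum A + eps B, with B the closed Euclidean unit ball. *)
Definition fatten (R : realType) (m : nat) (A : set 'rV[R]_m) (eps : R) :
    set 'rV[R]_m :=
  [set x + eps *: b | x in A & b in [set b : 'rV[R]_m | enorm b <= 1]].

(* Main.v *)
Require Import Defs.
From HB Require Import structures.
From mathcomp Require Import all_boot all_order all_algebra.
From mathcomp Require Import all_classical all_reals all_analysis.
From mathcomp Require Import ring lra.

Set Implicit Arguments.
Unset Strict Implicit.
Unset Printing Implicit Defensive.

Import Order.TTheory GRing.Theory Num.Theory.
Import numFieldNormedType.Exports.

Local Open Scope classical_set_scope.
Local Open Scope ring_scope.

(** The penalty is exact because an infeasible point can be repaired at a price
    in g that the penalty weights exceed.

    Everything is done with directional derivatives.  A directionally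
    differentiable, locally Lipschitz map has the same derivative along every
    curve with a given initial velocity, not only along rays
    ([velocity_comp]).  Hence the chain rule holds, and the derivative of the
    penalized objective at z in direction d is
      F'(z; d) + sum_l beta_l N_l'(r_l; s_l(d)),
    where r_l is the residual u_l - psi_l(theta, u_<l), s_l(d) is its rate of
    change d_l - psi_l'(...; d_<l), and N_l is the l1 norm on layer l.

    As s_l(d) is d_l minus a function of the earlier blocks of d only, any
    prescribed rates s_l and any theta part are realized by some direction,
    found block by block ([exists_dresidual]).  If two directions d, d' have
    the same theta part, then the Lipschitz bounds give, for the difference e of
    their u parts,
      |e_l| <= |s_l(d) - s_l(d')| + K_l |e_<l|,
    and unrolling this recursion yields
      |F'(z; d) - F'(z; d')| <= sum_l w_l |s_l(d) - s_l(d')|,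
      where w_l = Kg prod_(j > l) (1 + K_j) < beta_l  ([dobjective_gap]).

    This inequality is used twice.

    - Stationary points of the penalized problem in the level set are feasible
      ([dpenalized_ge0_feasible]): compare the zero direction with the direction
      of theta part 0 and rates s = - r.  Along the latter the penalty
      decreases at rate sum_l beta_l |r_l|_1, while F grows at rate at most
      sum_l w_l |r_l|_1; so r = 0.

    - At a feasible z, stationarity for the constrained problem implies
      stationarity for the penalized one ([objective_stationary_penalized]):
      compare d with the direction d' of the same theta part and rates 0.
      Re-solving the layer equations along theta + t dtheta gives a feasible
      curve with velocity d', so d' is tangent ([feasible_tangent]) and
      F'(z; d') >= 0; what F loses between d' and d is paid by the penalty.

    Conversely, F and the penalized objective agree on feasible points, hence
    have the same derivative along tangent directions
    ([tangent_dobjective_dpenalized]).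

    For global minimizers, the penalized objective has compact level sets, so it
    has a minimizer; its minimizers are stationary, hence feasible, and on
    feasible points the two objectives coincide. *)

(** * Euclidean and l1 norms *)

Section EuclideanNorm.
Context (R : realType).

Lemma enorm_ge0 m (x : 'rV[R]_m) : 0 <= enorm x.
Proof. exact: sqrtr_ge0. Qed.

Lemma enorm_sqr m (x : 'rV[R]_m) : enorm x ^+ 2 = \sum_(i < m) x 0 i ^+ 2.
Proof. by rewrite sqr_sqrtr// sumr_ge0// => i _; exact: sqr_ge0. Qed.

Lemma enormZ m (a : R) (x : 'rV[R]_m) : 0 <= a -> enorm (a *: x) = a * enorm x.
Proof.
move=> a0; rewrite /enorm; under eq_bigr do rewrite mxE exprMn.
by rewrite -mulr_sumr sqrtrM ?sqr_ge0// sqrtr_sqr ger0_norm.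
Qed.

Lemma enorm0 m : enorm (0 : 'rV[R]_m) = 0.
Proof. by rewrite -(scale0r (0 : 'rV[R]_m)) enormZ ?mul0r. Qed.

Lemma dot_le_enorm m (x y : 'rV[R]_m) :
  \sum_(i < m) x 0 i * y 0 i <= enorm x * enorm y.
Proof.
have zero (z w : 'rV[R]_m) : enorm z = 0 -> \sum_i z 0 i * w 0 i = 0.
  move=> /(congr1 (fun t => t ^+ 2)); rewrite enorm_sqr expr0n/= => /eqP.
  rewrite psumr_eq0 => [/allP z0|i _]; last exact: sqr_ge0.
  apply: big1 => i _; have /z0 := mem_index_enum i.
  by rewrite sqrf_eq0 => /eqP ->; rewrite mul0r.
have [x0|x0] := eqVneq (enorm x) 0; first by rewrite zero// x0 mul0r.
have [y0|y0] := eqVneq (enorm y) 0.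
  by under eq_bigr do rewrite mulrC; rewrite zero// y0 mulr0.
have xp : 0 < enorm x by rewrite lt_def x0 enorm_ge0.
have yp : 0 < enorm y by rewrite lt_def y0 enorm_ge0.
(* AM-GM on each term, with weights that make both sums of squares equal *)
have : \sum_i 2 * (enorm x * enorm y * (x 0 i * y 0 i)) <=
    \sum_i (enorm y ^+ 2 * x 0 i ^+ 2 + enorm x ^+ 2 * y 0 i ^+ 2).
  apply: ler_sum => i _; rewrite -subr_ge0.
  have := sqr_ge0 (enorm y * x 0 i - enorm x * y 0 i); congr (_ <= _).
  by ring.
rewrite -!mulr_sumr big_split/= -!mulr_sumr -!enorm_sqr.
rewrite (mulrC (enorm y ^+ 2)) -mulr2n -(mulr_natl (_ * _)) ler_pM2l//
  -exprMn expr2.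
by rewrite ler_pM2l ?mulr_gt0.
Qed.

Lemma enormD m (x y : 'rV[R]_m) : enorm (x + y) <= enorm x + enorm y.
Proof.
rewrite -ler_sqr ?nnegrE ?addr_ge0 ?enorm_ge0// sqrrD !enorm_sqr.
under eq_bigr do rewrite mxE sqrrD.
rewrite !big_split/= lerD2r lerD2l -mulr2n lerMn2r.
exact: dot_le_enorm.
Qed.

Lemma l1norm_ge0 m (x : 'rV[R]_m) : 0 <= l1norm x.
Proof. exact: sumr_ge0. Qed.

Lemma l1normN m (x : 'rV[R]_m) : l1norm (- x) = l1norm x.
Proof. by apply: eq_bigr => i _; rewrite mxE normrN. Qed.

Lemma enorm_le_l1norm m (x : 'rV[R]_m) : enorm x <= l1norm x.
Proof.
rewrite -ler_sqr ?nnegrE ?enorm_ge0 ?l1norm_ge0// enorm_sqr expr2 mulr_suml.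
apply: ler_sum => i _; rewrite -real_normK ?num_real// expr2 ler_wpM2l//.
by rewrite /l1norm (bigD1 i)//= lerDl sumr_ge0.
Qed.

Lemma l1norm_eq0 m (x : 'rV[R]_m) : l1norm x = 0 -> x = 0.
Proof.
move=> /eqP; rewrite psumr_eq0// => /allP x0; apply/rowP => i; rewrite mxE.
by apply/eqP; rewrite -normr_eq0; apply: x0; rewrite mem_index_enum.
Qed.

Lemma ler_coord_norm m (x : 'rV[R]_m) i : `|x 0 i| <= `|x|.
Proof.
rewrite [leRHS]/Num.norm/= mx_normrE; apply/bigmax_geP; right => /=.
by exists (0, i).
Qed.

Lemma norm_le_coord m (x : 'rV[R]_m) (M : R) :
  0 <= M -> (forall i, `|x 0 i| <= M) -> `|x| <= M.
Proof.
move=> M0 xM; rewrite [leLHS]/Num.norm/= mx_normrE.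
apply/bigmax_leP; split=> //.
by move=> [i j] _; rewrite /= ord1.
Qed.

Lemma norm_le_enorm m (x : 'rV[R]_m) : `|x| <= enorm x.
Proof.
apply: norm_le_coord => [|i]; first exact: enorm_ge0.
rewrite -ler_sqr ?nnegrE ?enorm_ge0// enorm_sqr real_normK ?num_real//.
by rewrite (bigD1 i)//= lerDl sumr_ge0// => j _; exact: sqr_ge0.
Qed.

Lemma cvg_rV (T : Type) (F : set_system T) {FF : Filter F} m
    (f : T -> 'rV[R]_m) (l : 'rV[R]_m) :
  (forall i, f x 0 i @[x --> F] --> l 0 i) -> f @ F --> l.
Proof.
move=> fl; apply/cvgrPdist_le => e e0.
have : \forall x \near F, forall i, `|l 0 i - f x 0 i| <= e.
  by apply: filter_forall => i; move/cvgrPdist_le : (fl i); apply.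
by apply: filterS => x xe; apply: norm_le_coord (ltW e0) _ => i; rewrite !mxE.
Qed.

Lemma cvg_coord (T : Type) (F : set_system T) {FF : Filter F} m
    (f : T -> 'rV[R]_m) (l : 'rV[R]_m) i :
  f @ F --> l -> f x 0 i @[x --> F] --> l 0 i.
Proof.
move=> fl.
apply: (@continuous_cvg _ _ _ F FF f (fun M : 'rV[R]_m => M 0 i) l) fl.
exact: coord_continuous.
Qed.

Lemma cvg_bigsum (T : Type) (F : set_system T) {FF : Filter F} (I : Type)
    (r : seq I) (f : I -> T -> R) (l : I -> R) :
  (forall i, f i x @[x --> F] --> l i) ->
  (\sum_(i <- r) f i x) @[x --> F] --> \sum_(i <- r) l i.
Proof.
move=> fl; elim: r => [|i r IH].
  by under eq_fun do rewrite big_nil; rewrite big_nil; exact: cvg_cst.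
by under eq_fun do rewrite big_cons; rewrite big_cons; exact: cvgD.
Qed.

Lemma enorm_continuous m : continuous (@enorm R m).
Proof.
move=> x; apply: continuous_comp; last exact: sqrt_continuous.
by apply: (@cvg_bigsum _ (nbhs x)) => i; apply: cvgM; exact: coord_continuous.
Qed.

Lemma l1norm_continuous m : continuous (@l1norm R m).
Proof.
move=> x; apply: (@cvg_bigsum _ (nbhs x)) => i; apply: cvg_norm.
exact: coord_continuous.
Qed.

End EuclideanNorm.

(** * Velocities of curves and the chain rule *)
(** The initial velocity of a curve sampled along a sequence of times tau.
    Sequences suffice for one-sided limits at 0, and they are the form in which
    tangent directions are given. *)
Definition velocity (R : realType) (V : normedModType R) (tau : nat -> R)
    (c : nat -> V) (x d : V) : Prop :=
  (tau k)^-1 *: (c k - x) @[k --> \oo] --> d.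

(** The one-sided directional derivative of the absolute value at a along b. *)
Definition dabs (R : realType) (a b : R) : R :=
  if a == 0 then `|b| else Num.sg a * b.

(** The directional derivative of the l1 norm at r along w. *)
Definition dl1norm (R : realType) (m : nat) (r w : 'rV[R]_m) : R :=
  \sum_(i < m) dabs (r 0 i) (w 0 i).

Lemma dl1norm0 (R : realType) (m : nat) (w : 'rV[R]_m) :
  dl1norm 0 w = l1norm w.
Proof. by apply: eq_bigr => i _; rewrite /dabs mxE eqxx. Qed.

(** The penalty decreases at full rate when the residual is contracted to 0. *)
Lemma dl1normN (R : realType) (m : nat) (r : 'rV[R]_m) :
  dl1norm r (- r) = - l1norm r.
Proof.
rewrite /l1norm -sumrN; apply: eq_bigr => i _; rewrite /dabs mxE.
case: eqVneq => [->|_]; first by rewrite oppr0 normr0 oppr0.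
by rewrite mulrN -normrEsg.
Qed.

Section Velocity.
Context (R : realType) (tau : nat -> R).
Context (tau_gt0 : forall k, 0 < tau k).
Context (tau_cvg0 : tau k @[k --> \oo] --> (0 : R)).

Lemma velocity_cst (V : normedModType R) (x : V) :
  velocity tau (fun=> x) x 0.
Proof.
by rewrite /velocity; under eq_fun do rewrite subrr scaler0; exact: cvg_cst.
Qed.

Lemma velocity_ray (V : normedModType R) (x d : V) :
  velocity tau (fun k => x + tau k *: d) x d.
Proof.
rewrite /velocity; under eq_fun => k.
  by rewrite (addrC x) addrK scalerA mulVf ?gt_eqF// scale1r; over.
exact: cvg_cst.
Qed.

Lemma velocity_cvg (V : normedModType R) (c : nat -> V) (x d : V) :
  velocity tau c x d -> c k @[k --> \oo] --> x.
Proof.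
move=> cd; have -> : c = fun k => tau k *: ((tau k)^-1 *: (c k - x)) + x.
  by apply/funext => k; rewrite scalerA divff ?gt_eqF// scale1r subrK.
rewrite -[X in _ --> X]add0r -(scale0r d).
by apply: cvgD; [exact: cvgZ|exact: cvg_cst].
Qed.

Lemma velocityD (V : normedModType R) (c e : nat -> V) (x y d f : V) :
  velocity tau c x d -> velocity tau e y f ->
  velocity tau (fun k => c k + e k) (x + y) (d + f).
Proof.
move=> cd ef; rewrite /velocity; under eq_fun do rewrite opprD addrACA scalerDr.
exact: cvgD.
Qed.

Lemma velocityZ (V : normedModType R) (a : R) (c : nat -> V) (x d : V) :
  velocity tau c x d -> velocity tau (fun k => a *: c k) (a *: x) (a *: d).
Proof.
move=> cd; rewrite /velocity.
under eq_fun do rewrite -scalerBr scalerA mulrC -scalerA.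
exact: cvgZl_tmp.
Qed.

Lemma velocityN (V : normedModType R) (c : nat -> V) (x d : V) :
  velocity tau c x d -> velocity tau (fun k => - c k) (- x) (- d).
Proof.
move=> cd; rewrite /velocity; under eq_fun do rewrite -opprD scalerN.
exact: cvgN.
Qed.

Lemma velocity_sum (V : normedModType R) (I : Type) (r : seq I)
    (c : I -> nat -> V) (x d : I -> V) :
  (forall i, velocity tau (c i) (x i) (d i)) ->
  velocity tau (fun k => \sum_(i <- r) c i k) (\sum_(i <- r) x i)
    (\sum_(i <- r) d i).
Proof.
move=> cd; elim: r => [|i r IH].
  rewrite !big_nil; under [X in velocity _ X]eq_fun do rewrite big_nil.
  exact: velocity_cst.
rewrite !big_cons; under [X in velocity _ X]eq_fun do rewrite big_cons.
exact: velocityD.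
Qed.

Lemma velocity_rV m (c : nat -> 'rV[R]_m) (x d : 'rV[R]_m) :
  (forall i, velocity tau (fun k => c k 0 i) (x 0 i) (d 0 i)) ->
  velocity tau c x d.
Proof.
move=> cd; apply: cvg_rV => i; under eq_fun do rewrite !mxE.
exact: cd.
Qed.

Lemma velocity_coord m (c : nat -> 'rV[R]_m) (x d : 'rV[R]_m) i :
  velocity tau c x d -> velocity tau (fun k => c k 0 i) (x 0 i) (d 0 i).
Proof.
by move=> /(@cvg_coord R _ _ _ m _ _ i); under eq_fun do rewrite !mxE.
Qed.

Lemma velocity_sqr (c : nat -> R) (x d : R) :
  velocity tau c x d ->
  velocity tau (fun k => c k ^+ 2) (x ^+ 2) (x * d *+ 2).
Proof.
move=> cd; have -> : x * d *+ 2 = d * (x + x) by ring.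
apply: cvg_trans (cvgM cd (cvgD (velocity_cvg cd) (cvg_cst x))).
apply: near_eq_cvg; apply: nearW => k /=.
by rewrite subr_sqr /GRing.scale/= mulrA.
Qed.

Lemma velocity_abs (c : nat -> R) (x d : R) :
  velocity tau c x d -> velocity tau (fun k => `|c k|) `|x| (dabs x d).
Proof.
move=> cd; rewrite /dabs; case: eqVneq cd => [->|x0] cd.
  apply: cvg_trans (cvg_norm cd); apply: near_eq_cvg; apply: nearW => k /=.
  by rewrite normr0 !subr0 normrZ gtr0_norm ?invr_gt0.
have near_sg : \forall k \near \oo, Num.sg (c k) = Num.sg x.
  have cx := velocity_cvg cd; case: (ltgtP x 0) x0 => // x0 _.
    by apply: filterS (cvgr_lt _ cx _ x0) => k ck; rewrite !ltr0_sg.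
  by apply: filterS (cvgr_gt _ cx _ x0) => k ck; rewrite !gtr0_sg.
apply: cvg_trans (_ : _ --> Num.sg x *: d); last exact: velocityZ cd.
apply: near_eq_cvg; apply: filterS near_sg => k sgE.
by rewrite !normrEsg sgE.
Qed.

Lemma velocity_l1norm m (c : nat -> 'rV[R]_m) (x d : 'rV[R]_m) :
  velocity tau c x d ->
  velocity tau (fun k => l1norm (c k)) (l1norm x) (dl1norm x d).
Proof.
by move=> cd; apply: velocity_sum => i; exact/velocity_abs/velocity_coord.
Qed.

(** The curve stays within o(tau) of the ray of direction d, and the Lipschitz
    property at x transfers this to the images, so the derivative along the ray
    is also the derivative along the curve.  This is what makes directional
    derivatives compose. *)
Lemma velocity_comp (V W : normedModType R) (f : V -> W) (c : nat -> V)
    (x d : V) :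
  dir_differentiable f -> locally_lipschitz f -> velocity tau c x d ->
  velocity tau (f \o c) (f x) (dir_deriv f x d).
Proof.
move=> fd fl cd.
have ray_cvg : dir_quotient f x d (tau k) @[k --> \oo] --> dir_deriv f x d.
  apply: (@cvg_comp _ _ _ tau _ \oo 0^'+ _ _ (fd x d)) => A A0.
  have near_A : \forall k \near \oo, 0 < tau k -> A (tau k).
    exact: tau_cvg0 A0.
  by apply: filterS near_A => k /(_ (tau_gt0 k)).
have dev_cvg0 : (tau k)^-1 *: (f (c k) - f (x + tau k *: d)) @[k --> \oo]
    --> (0 : W).
  have [M M0 lipM] := pinfty_ex_gt0 (fl x).
  have pair_cvg : (c k, x + tau k *: d) @[k --> \oo] --> (x, x).
    exact: cvg_pair (velocity_cvg cd) (velocity_cvg (@velocity_ray _ x d)).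
  apply/cvgrPdist_le => e e0.
  have eM : 0 < e / M by rewrite divr_gt0.
  have /cvgrPdist_le/(_ _ eM) near_d := cd.
  near=> k.
  rewrite sub0r normrN normrZ gtr0_norm ?invr_gt0// ler_pdivrMl//.
  have /le_trans : `|f (c k) - f (x + tau k *: d)| <=
      M * `|c k - (x + tau k *: d)|.
    by near: k; exact: (pair_cvg _ lipM).
  apply; rewrite opprD addrA.
  have -> : c k - x - tau k *: d = tau k *: ((tau k)^-1 *: (c k - x) - d).
    by rewrite scalerBr scalerA divff ?gt_eqF// scale1r.
  rewrite normrZ gtr0_norm// mulrCA ler_pM2l// mulrC -ler_pdivlMr//.
  by rewrite distrC; near: k.
rewrite /velocity -[X in _ --> X]add0r.
under eq_fun => k.
  rewrite /= -(subrK (f (x + tau k *: d)) (f (c k))) -addrA scalerDr; over.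
exact: cvgD.
Unshelve. all: by end_near. Qed.

End Velocity.

(** * Block structure of the layers *)
Section Layers.
Context (R : realType) (L : nat) (N : nat -> nat).
Implicit Types (u v e : 'rV[R]_(\sum_(j < L) N j)).

Lemma enorm_mxrow k (p : 'I_k -> nat) (B : forall j, 'rV[R]_(p j)) :
  enorm (\mxrow_j B j) ^+ 2 = \sum_(j < k) enorm (B j) ^+ 2.
Proof.
under [RHS]eq_bigr do rewrite enorm_sqr.
rewrite enorm_sqr sig_big_dep/= (reindex _ tagnat.sig_bij_on)/=.
by apply: eq_bigr => t _; rewrite mxE.
Qed.

Lemma ublock_mxrow (B : forall l : 'I_L, 'rV[R]_(N l)) l :
  ublock (\mxrow_l B l) l = B l.
Proof. exact: mxrowK. Qed.

Lemma ublockB u v l : ublock (u - v) l = ublock u l - ublock v l.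
Proof. exact: submxrowB. Qed.

Lemma uprefix_ext u v (l : 'I_L) :
  (forall j : 'I_L, (j < l)%N -> ublock u j = ublock v j) ->
  uprefix u l = uprefix v l.
Proof. by move=> uv; apply: eq_mxrow => j; rewrite uv//=. Qed.

Lemma uprefixB u v l : uprefix (u - v) l = uprefix u l - uprefix v l.
Proof. by rewrite -mxrowB; apply: eq_mxrow => j; rewrite ublockB. Qed.

Lemma enorm_ublock u : enorm u ^+ 2 = \sum_(l < L) enorm (ublock u l) ^+ 2.
Proof. by rewrite -[in LHS](submxrowK u) enorm_mxrow. Qed.

Lemma enorm_uprefix u (l : 'I_L) :
  enorm (uprefix u l) ^+ 2 = \sum_(j < L | (j < l)%N) enorm (ublock u j) ^+ 2.
Proof.
rewrite enorm_mxrow (big_ord_narrow (ltnW (ltn_ord l))); exact: eq_bigr.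
Qed.

(** Each block is determined by the earlier ones, so iterating the update L
    times from any start stabilizes the blocks one after the other. *)
Lemma layered_fixpoint
    (Phi : forall l : 'I_L, 'rV[R]_(\sum_(j < l) N j) -> 'rV[R]_(N l)) :
  exists u, forall l, ublock u l = Phi l (uprefix u l).
Proof.
pose T u : 'rV[R]_(\sum_(j < L) N j) := \mxrow_(l < L) Phi l (uprefix u l).
have TE u l : ublock (T u) l = Phi l (uprefix u l) by exact: ublock_mxrow.
have stable k (l : 'I_L) : (l < k)%N ->
    ublock (iter k T 0) l = ublock (iter k.+1 T 0) l.
  elim: k l => // k IH l lk; rewrite !iterS !TE; congr Phi.
  by apply: uprefix_ext => j jl; rewrite IH// (leq_trans jl).
by exists (iter L T 0) => l; rewrite stable// iterS TE.
Qed.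

(** Discrete Gronwall inequality.  By Pythagoras and subadditivity of the
    square root, the norm E k of the first k blocks satisfies
    E (k+1) <= E k + (a k + K k * E k), starting from E 0 = 0. *)
Lemma layered_enorm_le (K : nat -> R) e (a : 'I_L -> R) :
  (forall l, (0 < l < L)%N -> 0 <= K l) ->
  (forall l, enorm (ublock e l) <= a l + K l * enorm (uprefix e l)) ->
  enorm e <= \sum_(l < L) a l * \prod_(l.+1 <= j < L) (1 + K j).
Proof.
move=> K_ge0 step.
pose E k := Num.sqrt (\sum_(l < L | (l < k)%N) enorm (ublock e l) ^+ 2).
pose B k := \sum_(l < L | (l < k)%N) a l * \prod_(l.+1 <= j < k) (1 + K j).
have EE k : E k ^+ 2 = \sum_(l < L | (l < k)%N) enorm (ublock e l) ^+ 2.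
  by rewrite sqr_sqrtr// sumr_ge0// => l _; exact: sqr_ge0.
have EL : E L = enorm e.
  rewrite /E (eq_bigl xpredT) => [|l]; last by rewrite ltn_ord.
  by rewrite -enorm_ublock sqrtr_sqr ger0_norm ?enorm_ge0.
have Epre (l : 'I_L) : E l = enorm (uprefix e l).
  by rewrite /E -enorm_uprefix sqrtr_sqr ger0_norm ?enorm_ge0.
have E0 : E 0 = 0 by rewrite /E big_pred0// sqrtr0.
have B0 : B 0 = 0 by rewrite /B big_pred0.
have EB k : (k <= L)%N -> E k <= B k.
  elim: k => [_|k IH kL]; first by rewrite E0 B0.
  pose l := Ordinal kL.
  have ltE (j : 'I_L) : ((j < k.+1) && (j != l))%N = (j < k)%N.
    by rewrite ltnS -val_eqE/= [RHS]ltn_neqAle andbC.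
  have Ek1 : E k.+1 <= E k + enorm (ublock e l).
    rewrite -ler_sqr ?nnegrE ?addr_ge0 ?enorm_ge0 ?sqrtr_ge0// sqrrD.
    rewrite !EE (bigD1 l)//= (eq_bigl _ _ ltE) addrC lerD2r lerDl.
    by rewrite mulrn_wge0// mulr_ge0 ?enorm_ge0 ?sqrtr_ge0.
  have Bk1 : B k.+1 = a l + (1 + K k) * B k.
    rewrite /B (bigD1 l)//= (eq_bigl _ _ ltE) big_geq// mulr1; congr +%R.
    rewrite mulr_sumr; apply: eq_bigr => j jk.
    by rewrite big_nat_recr//= mulrA mulrC.
  (* 1 + K 0 may be negative, but E 0 = B 0 = 0 *)
  have growth : (1 + K k) * E k <= (1 + K k) * B k.
    case: k => [|k] in kL IH l ltE Ek1 Bk1 *; first by rewrite E0 B0 !mulr0.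
    by rewrite ler_wpM2l ?addr_ge0 ?K_ge0// IH// ltnW.
  rewrite (le_trans Ek1)// Bk1; apply: le_trans (lerD (lexx (a l)) growth).
  by have := step l; rewrite -Epre/= mulrDl mul1r; lra.
rewrite -EL (le_trans (EB L _))// /B (eq_bigl xpredT)// => l.
by rewrite ltn_ord.
Qed.

Section LayerVelocity.
Context (tau : nat -> R).

Lemma velocity_ublock (c : nat -> 'rV[R]_(\sum_(j < L) N j)) u e l :
  velocity tau c u e ->
  velocity tau (fun k => ublock (c k) l) (ublock u l) (ublock e l).
Proof.
move=> ce; apply: velocity_rV => i; rewrite !mxE.
under [X in velocity _ X]eq_fun do rewrite mxE.
exact: velocity_coord.
Qed.

(** Only the earlier blocks are involved, which allows induction on layers in
    [feasible_tangent]. *)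
Lemma velocity_uprefix (c : nat -> 'rV[R]_(\sum_(j < L) N j)) u e (l : 'I_L) :
  (forall j : 'I_L, (j < l)%N ->
    velocity tau (fun k => ublock (c k) j) (ublock u j) (ublock e j)) ->
  velocity tau (fun k => uprefix (c k) l) (uprefix u l) (uprefix e l).
Proof.
move=> ce; apply: velocity_rV => i; rewrite mxE [X in velocity _ _ _ X]mxE.
under [X in velocity _ X]eq_fun do rewrite mxE.
pose j := widen_ord (ltnW (ltn_ord l)) (tagnat.sig1 i).
have jl : (j < l)%N by exact: (ltn_ord (tagnat.sig1 i)).
exact: velocity_coord (ce j jl).
Qed.

Lemma velocity_row_mx m1 m2 (c1 : nat -> 'rV[R]_m1) (c2 : nat -> 'rV[R]_m2)
    x1 x2 d1 d2 :
  velocity tau c1 x1 d1 -> velocity tau c2 x2 d2 ->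
  velocity tau (fun k => row_mx (c1 k) (c2 k)) (row_mx x1 x2) (row_mx d1 d2).
Proof.
move=> cd1 cd2; apply: velocity_rV => i; rewrite !mxE.
under [X in velocity _ X]eq_fun do rewrite mxE.
by case: splitP => j _; exact: velocity_coord.
Qed.

Lemma velocity_lsubmx m1 m2 (c : nat -> 'rV[R]_(m1 + m2)) x d :
  velocity tau c x d ->
  velocity tau (fun k => lsubmx (c k)) (lsubmx x) (lsubmx d).
Proof.
move=> cd; apply: velocity_rV => i; rewrite !mxE.
under [X in velocity _ X]eq_fun do rewrite mxE.
exact: velocity_coord.
Qed.

Lemma velocity_rsubmx m1 m2 (c : nat -> 'rV[R]_(m1 + m2)) x d :
  velocity tau c x d ->
  velocity tau (fun k => rsubmx (c k)) (rsubmx x) (rsubmx d).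
Proof.
move=> cd; apply: velocity_rV => i; rewrite !mxE.
under [X in velocity _ X]eq_fun do rewrite mxE.
exact: velocity_coord.
Qed.

End LayerVelocity.
End Layers.

(** * Directional derivatives of the two objectives *)

Lemma velocity_unique (R : realType) (V : normedModType R) (tau : nat -> R)
    (c : nat -> V) (x d e : V) :
  velocity tau c x d -> velocity tau c x e -> d = e.
Proof. exact: norm_cvg_unique. Qed.

(** Lipschitz bounds between two curves pass to their velocities.  The gauge nu
    is either the absolute value or the Euclidean norm. *)
Lemma velocity_gap (R : realType) (V : normedModType R) (nu : V -> R)
    (tau : nat -> R) (c e : nat -> V) (x d f : V) (C : R) :
  continuous nu -> (forall a v, 0 <= a -> nu (a *: v) = a * nu v) ->
  (forall k, 0 < tau k) ->
  velocity tau c x d -> velocity tau e x f ->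
  (\forall k \near \oo, nu (c k - e k) <= tau k * C) -> nu (d - f) <= C.
Proof.
move=> nu_cont nuZ tau_gt0 cd ef near_le.
have diff_cvg : (tau k)^-1 *: (c k - x) - (tau k)^-1 *: (e k - x) @[k --> \oo]
    --> d - f by exact: cvgB.
apply: (@cvgr_to_le _ \oo _ _ _ (nu (d - f)) C).
  by apply: continuous_cvg diff_cvg; exact: nu_cont.
apply: filterS near_le => k /=.
by rewrite -scalerBr opprB addrA subrK nuZ ?ler_pdivrMl// invr_ge0 ltW.
Qed.

(** Both objectives are differentiated along arbitrary sequences of times; this
    recovers the limit at 0 from the right. *)
Lemma dir_derivE (R : realType) (V : normedModType R) (f : V -> R) (x d : V)
    (l : R) :
  (forall tau : nat -> R, (forall k, 0 < tau k) ->
    tau k @[k --> \oo] --> (0 : R) ->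
    velocity tau (fun k => f (x + tau k *: d)) (f x) l) ->
  dir_deriv f x d = l.
Proof.
move=> fl; apply: cvg_lim => //; apply/cvg_at_rightP => tau [tau_gt0 tau0].
exact: fl.
Qed.

Lemma dir_deriv0 (R : realType) (V W : normedModType R) (f : V -> W) (x : V) :
  dir_deriv f x 0 = 0.
Proof.
apply: cvg_lim => //; rewrite /dir_quotient.
under eq_fun do rewrite scaler0 addr0 subrr scaler0.
exact: cvg_cst.
Qed.

Section Penalty.
Context (R : realType) (n L : nat) (N : nat -> nat).
Context (g : 'rV[R]_(\sum_(j < L) N j) -> R).
Context (psi : forall l : 'I_L, 'rV[R]_(n + \sum_(j < l) N j) -> 'rV[R]_(N l)).
Context (lambda : R) (beta : 'I_L -> R).
Context (g_ddiff : dir_differentiable g).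
Context (psi_ddiff : forall l : 'I_L, dir_differentiable (@psi l)).
Context (g_loclip : locally_lipschitz g).
Context (psi_loclip : forall l : 'I_L, locally_lipschitz (@psi l)).

Implicit Types (z d : 'rV[R]_(n + \sum_(j < L) N j)) (l : 'I_L).

Definition residual z l : 'rV[R]_(N l) :=
  ublock (rsubmx z) l - activation psi (lsubmx z) (rsubmx z) l.

(** The point at which psi l is evaluated to obtain layer l of z. *)
Definition layer_arg z l : 'rV[R]_(n + \sum_(j < l) N j) :=
  row_mx (lsubmx z) (uprefix (rsubmx z) l).

Definition dactivation z d l : 'rV[R]_(N l) :=
  dir_deriv (@psi l) (layer_arg z l) (layer_arg d l).

(** The rate of change of [residual] at z in direction d. *)
Definition dresidual z d l : 'rV[R]_(N l) :=
  ublock (rsubmx d) l - dactivation z d l.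

Definition dobjective z d : R :=
  dir_deriv g (rsubmx z) (rsubmx d) +
  lambda * \sum_(i < n) (lsubmx z 0 i * lsubmx d 0 i) *+ 2.

Definition dpenalized z d : R :=
  dobjective z d +
  \sum_(l < L) beta l * dl1norm (residual z l) (dresidual z d l).

Section Curve.
Context (tau : nat -> R) (tau_gt0 : forall k, 0 < tau k).
Context (tau_cvg0 : tau k @[k --> \oo] --> (0 : R)).
Context (c : nat -> 'rV[R]_(n + \sum_(j < L) N j)).
Context (z d : 'rV[R]_(n + \sum_(j < L) N j)) (cd : velocity tau c z d).

Lemma velocity_objective :
  velocity tau (objective g lambda \o c) (objective g lambda z)
    (dobjective z d).
Proof.
apply: velocityD.
  exact: (velocity_comp tau_gt0 tau_cvg0 g_ddiff g_loclip (velocity_rsubmx cd)).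
rewrite enorm_sqr; under [X in velocity _ X]eq_fun do rewrite enorm_sqr.
apply: velocityZ; apply: velocity_sum => i.
by apply: velocity_sqr => //; exact/velocity_coord/velocity_lsubmx.
Qed.

Lemma velocity_activation l :
  velocity tau (fun k => activation psi (lsubmx (c k)) (rsubmx (c k)) l)
    (activation psi (lsubmx z) (rsubmx z) l) (dactivation z d l).
Proof.
have arg_vel : velocity tau (fun k => layer_arg (c k) l) (layer_arg z l)
    (layer_arg d l).
  apply: velocity_row_mx; first exact: velocity_lsubmx.
  by apply: velocity_uprefix => j _; exact/velocity_ublock/velocity_rsubmx.
exact: (velocity_comp tau_gt0 tau_cvg0 (@psi_ddiff l) (@psi_loclip l) arg_vel).
Qed.

Lemma velocity_penalized :
  velocity tau (penalized g psi lambda beta \o c)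
    (penalized g psi lambda beta z) (dpenalized z d).
Proof.
apply: velocityD; first exact: velocity_objective.
apply: velocity_sum => l; apply: velocityZ; apply: velocity_l1norm => //.
apply: velocityD; first exact/velocity_ublock/velocity_rsubmx.
exact/velocityN/velocity_activation.
Qed.

End Curve.

Lemma dir_deriv_objective z d :
  dir_deriv (objective g lambda) z d = dobjective z d.
Proof.
apply: dir_derivE => tau tau_gt0 tau0.
have ray := velocity_ray tau_gt0 z (d := d).
exact: (velocity_objective tau_gt0 tau0 ray).
Qed.

Lemma dir_deriv_penalized z d :
  dir_deriv (penalized g psi lambda beta) z d = dpenalized z d.
Proof.
apply: dir_derivE => tau tau_gt0 tau0.
have ray := velocity_ray tau_gt0 z (d := d).
exact: (velocity_penalized tau_gt0 tau0 ray).
Qed.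

Lemma dobjective0 z : dobjective z 0 = 0.
Proof.
rewrite /dobjective raddf0 dir_deriv0 add0r big1 ?mulr0// => i _.
by rewrite !mxE mulr0 mul0rn.
Qed.

Lemma dresidual0 z l : dresidual z 0 l = 0.
Proof.
have arg0 : layer_arg 0 l = 0.
  rewrite /layer_arg !raddf0; apply/rowP => i.
  by rewrite !mxE; case: splitP => j _; rewrite !mxE.
rewrite /dresidual /dactivation arg0 dir_deriv0 subr0.
by apply/rowP => i; rewrite !mxE.
Qed.

(** The equations are triangular in the blocks of the unknown direction. *)
Lemma exists_dresidual z (dtheta : 'rV[R]_n) (s : forall l, 'rV[R]_(N l)) :
  exists v, forall l, dresidual z (row_mx dtheta v) l = s l.
Proof.
have [v vE] := layered_fixpoint (fun l p =>
  s l + dir_deriv (@psi l) (layer_arg z l) (row_mx dtheta p)).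
exists v => l.
by rewrite /dresidual /dactivation /layer_arg row_mxKl row_mxKr vE addrK.
Qed.

Lemma feasible_penalized z :
  feasible psi z -> penalized g psi lambda beta z = objective g lambda z.
Proof.
move=> zF; rewrite /penalized big1 ?addr0// => l _.
rewrite zF subrr /l1norm big1 ?mulr0// => i _.
by rewrite mxE normr0.
Qed.

(** Zero residual rates mean that d satisfies the linearized layer equations.
    The feasible curve through z obtained by solving the layer equations exactly
    along theta + tau dtheta then has velocity d: block l of its velocity is
    given by the chain rule from those of the earlier blocks. *)
Lemma feasible_tangent z d :
  feasible psi z -> (forall l, dresidual z d l = 0) ->
  tangent_cone (feasible psi) z d.
Proof.
move=> zF dres0; pose tau := @harmonic R.
have tau_gt0 k : 0 < tau k by exact: harmonic_gt0.
have tau0 : tau k @[k --> \oo] --> (0 : R) by exact: cvg_harmonic.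
pose theta k := lsubmx z + tau k *: lsubmx d.
have [u uE] := choice (fun k =>
  layered_fixpoint (fun l p => psi (row_mx (theta k) p))).
have u_block m l : (l < m)%N ->
    velocity tau (fun k => ublock (u k) l) (ublock (rsubmx z) l)
      (ublock (rsubmx d) l).
  elim: m l => // m IH l lm.
  have -> : ublock (rsubmx d) l = dactivation z d l by exact/subr0_eq/dres0.
  rewrite zF; under [X in velocity _ X]eq_fun do rewrite uE.
  have arg_vel : velocity tau (fun k => row_mx (theta k) (uprefix (u k) l))
      (layer_arg z l) (layer_arg d l).
    apply: velocity_row_mx; first exact: velocity_ray.
    by apply: velocity_uprefix => j jl; apply: IH; rewrite (leq_trans jl).
  exact: (velocity_comp tau_gt0 tau0 (@psi_ddiff l) (@psi_loclip l) arg_vel).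
have u_vel : velocity tau (fun k => row_mx (theta k) (u k)) z d.
  rewrite -[z]hsubmxK -[d]hsubmxK; apply: velocity_row_mx.
    exact: velocity_ray.
  apply: velocity_rV => i.
  have E (v : 'rV[R]_(\sum_(j < L) N j)) :
      v 0 i = ublock v (tagnat.sig1 i) 0 (tagnat.sig2 i).
    by rewrite -[in LHS](submxrowK v) mxE.
  rewrite !E; under [X in velocity _ X]eq_fun do rewrite E.
  exact: velocity_coord (u_block _ _ (ltn_ord _)).
exists (fun k => row_mx (theta k) (u k)), tau; split=> //.
  by move=> k l; rewrite row_mxKl row_mxKr uE.
exact: (velocity_cvg tau_gt0 tau0 u_vel).
Qed.

End Penalty.

(** * The penalty dominates the cost of repairing residuals *)

Lemma fatten_nbhs (R : realType) m (A : set 'rV[R]_m) (eps : R) z :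
  0 < eps -> A z -> nbhs z (fatten A eps).
Proof.
move=> eps_gt0 Az.
have dist_cvg : enorm (w - z) @[w --> z] --> enorm (z - z).
  apply: (@continuous_cvg _ _ _ (nbhs z) _ (fun w => w - z) (@enorm R m)).
    exact: enorm_continuous.
  by apply: cvgB; [exact: cvg_id|exact: cvg_cst].
rewrite subrr enorm0 in dist_cvg.
apply: filterS (cvgr_lt _ dist_cvg _ eps_gt0) => w wz.
exists z => //; exists (eps^-1 *: (w - z)).
  rewrite /= enormZ; last by rewrite invr_ge0 ltW.
  by rewrite ler_pdivrMl// mulr1 ltW.
by rewrite scalerA divff ?gt_eqF// scale1r addrC subrK.
Qed.

Section ExactPenalty.
Context (R : realType) (n L : nat) (N : nat -> nat).
Context (g : 'rV[R]_(\sum_(j < L) N j) -> R).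
Context (psi : forall l : 'I_L, 'rV[R]_(n + \sum_(j < l) N j) -> 'rV[R]_(N l)).
Context (lambda : R) (beta : 'I_L -> R).
Context (g_ddiff : dir_differentiable g).
Context (psi_ddiff : forall l : 'I_L, dir_differentiable (@psi l)).
Context (g_loclip : locally_lipschitz g).
Context (psi_loclip : forall l : 'I_L, locally_lipschitz (@psi l)).

Context (Kg : R) (Kg_ge0 : 0 <= Kg).
Context (K : nat -> R) (K_ge0 : forall l, (0 < l < L)%N -> 0 <= K l).
Context (Omega : set 'rV[R]_(n + \sum_(j < L) N j)).
Context (g_lip : forall (theta : 'rV[R]_n) (u v : 'rV[R]_(\sum_(j < L) N j)),
  Omega (row_mx theta u) -> Omega (row_mx theta v) ->
  `|g u - g v| <= Kg * enorm (u - v)).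
Context (psi_lip : forall (l : 'I_L) (theta : 'rV[R]_n)
    (u v : 'rV[R]_(\sum_(j < L) N j)), (0 < l)%N ->
  Omega (row_mx theta u) -> Omega (row_mx theta v) ->
  enorm (psi (row_mx theta (uprefix u l)) - psi (row_mx theta (uprefix v l))) <=
    K l * enorm (uprefix u l - uprefix v l)).
Context (beta_large : forall l : 'I_L,
  Kg * \prod_(l.+1 <= j < L) (1 + K j) < beta l).

Context (z : 'rV[R]_(n + \sum_(j < L) N j)) (z_int : nbhs z Omega).
Implicit Types (d : 'rV[R]_(n + \sum_(j < L) N j)).

Let tau : nat -> R := @harmonic R.

Let tau_gt0 k : 0 < tau k.
Proof. exact: harmonic_gt0. Qed.

Let tau_cvg0 : tau k @[k --> \oo] --> (0 : R).
Proof. exact: cvg_harmonic. Qed.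

Let ray_near d : \forall k \near \oo, Omega (z + tau k *: d).
Proof.
exact: (velocity_cvg tau_gt0 tau_cvg0 (velocity_ray tau_gt0 z (d := d))).
Qed.

Let rsub_ray d k : rsubmx (z + tau k *: d) = rsubmx z + tau k *: rsubmx d.
Proof. by apply/rowP => i; rewrite !mxE. Qed.

Let lsub_ray d k : lsubmx (z + tau k *: d) = lsubmx z + tau k *: lsubmx d.
Proof. by apply/rowP => i; rewrite !mxE. Qed.

(** The quadratic term depends only on the theta part, so only g contributes. *)
Lemma dobjective_lipschitz d d' : lsubmx d = lsubmx d' ->
  `|dobjective g lambda z d - dobjective g lambda z d'| <=
    Kg * enorm (rsubmx d - rsubmx d').
Proof.
move=> dd'; rewrite /dobjective dd' opprD addrACA subrr addr0.
have vel e : velocity tau (fun k => g (rsubmx (z + tau k *: e))) (g (rsubmx z))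
    (dir_deriv g (rsubmx z) (rsubmx e)).
  have ray := velocity_rsubmx (velocity_ray tau_gt0 z (d := e)).
  exact: (velocity_comp tau_gt0 tau_cvg0 g_ddiff g_loclip ray).
apply: (velocity_gap (nu := Num.norm) _ _ tau_gt0 (vel d) (vel d')).
- exact: norm_continuous.
- by move=> a v a0; rewrite normrZ ger0_norm.
near=> k; have := @g_lip (lsubmx (z + tau k *: d)) (rsubmx (z + tau k *: d))
  (rsubmx (z + tau k *: d')).
rewrite hsubmxK lsub_ray dd' -lsub_ray hsubmxK => /(_ _ _)/le_trans; apply.
- by near: k; exact: ray_near.
- by near: k; exact: ray_near.
rewrite !rsub_ray opprD addrACA subrr add0r -scalerBr enormZ; last exact/ltW.
by rewrite mulrCA.
Unshelve. all: by end_near. Qed.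

Lemma dactivation_lipschitz d d' (l : 'I_L) : lsubmx d = lsubmx d' ->
  enorm (dactivation psi z d l - dactivation psi z d' l) <=
    K l * enorm (uprefix (rsubmx d - rsubmx d') l).
Proof.
move=> dd'.
(* the first layer has an empty prefix, so both sides vanish *)
have [l0|l_gt0] := leqP l 0.
  have pre_eq u v : uprefix u l = uprefix v l :> 'rV[R]_(\sum_(j < l) N j).
    by apply: uprefix_ext => j jl; have := leq_trans jl l0.
  rewrite /dactivation /layer_arg dd' (pre_eq (rsubmx d) (rsubmx d')) subrr.
  by rewrite uprefixB (pre_eq (rsubmx d) (rsubmx d')) subrr !enorm0 mulr0.
have vel e : velocity tau (fun k => activation psi (lsubmx (z + tau k *: e))
    (rsubmx (z + tau k *: e)) l) (activation psi (lsubmx z) (rsubmx z) l)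
    (dactivation psi z e l).
  have ray := velocity_ray tau_gt0 z (d := e).
  exact: (velocity_activation psi_ddiff psi_loclip tau_gt0 tau_cvg0 ray).
apply: (velocity_gap (nu := @enorm R (N l)) _ _ tau_gt0 (vel d) (vel d')).
- exact: enorm_continuous.
- by move=> a v a0; rewrite enormZ.
near=> k; have := @psi_lip l (lsubmx (z + tau k *: d))
  (rsubmx (z + tau k *: d)) (rsubmx (z + tau k *: d')) l_gt0.
rewrite /activation hsubmxK [lsubmx (z + _ *: d)]lsub_ray dd' -lsub_ray hsubmxK.
move=> /(_ _ _)/le_trans; apply.
- by near: k; exact: ray_near.
- by near: k; exact: ray_near.
rewrite -uprefixB !rsub_ray opprD addrACA subrr add0r -scalerBr.
have -> : uprefix (tau k *: (rsubmx d - rsubmx d')) l =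
    tau k *: uprefix (rsubmx d - rsubmx d') l.
  by apply/rowP => i; rewrite !mxE.
by rewrite enormZ; [rewrite mulrCA|exact/ltW].
Unshelve. all: by end_near. Qed.

Lemma direction_gap d d' : lsubmx d = lsubmx d' ->
  enorm (rsubmx d - rsubmx d') <=
    \sum_(l < L) enorm (dresidual psi z d l - dresidual psi z d' l) *
      \prod_(l.+1 <= j < L) (1 + K j).
Proof.
move=> dd'; apply: layered_enorm_le => // l; rewrite ublockB.
apply: le_trans (lerD (lexx _) (dactivation_lipschitz l dd')).
have -> : ublock (rsubmx d) l - ublock (rsubmx d') l =
    dresidual psi z d l - dresidual psi z d' l +
    (dactivation psi z d l - dactivation psi z d' l).
  by rewrite /dresidual opprB addrACA subrK addrAC subrr add0r.
exact: enormD.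
Qed.

(** The cost, in the objective, of changing the residual rates of a direction:
    the change in direction is bounded through the recursion on layers, and g
    is Kg-Lipschitz. *)
Lemma dobjective_gap d d' : lsubmx d = lsubmx d' ->
  `|dobjective g lambda z d - dobjective g lambda z d'| <=
    \sum_(l < L) Kg * \prod_(l.+1 <= j < L) (1 + K j) *
      l1norm (dresidual psi z d l - dresidual psi z d' l).
Proof.
move=> dd'; apply: le_trans (dobjective_lipschitz dd') _.
apply: le_trans (ler_wpM2l Kg_ge0 (direction_gap dd')) _.
rewrite mulr_sumr; apply: ler_sum => l _.
rewrite mulrCA [leLHS]mulrC ler_wpM2l ?enorm_le_l1norm// mulr_ge0//.
rewrite big_seq prodr_ge0// => j; rewrite mem_index_iota => /andP[lj jL].
by rewrite addr_ge0// K_ge0// jL (leq_ltn_trans _ lj).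
Qed.

(** The direction that moves no theta and contracts every residual at unit rate
    would be one of strict descent if some residual were nonzero. *)
Lemma dpenalized_ge0_feasible :
  (forall d, 0 <= dpenalized g psi lambda beta z d) -> feasible psi z.
Proof.
move=> stat.
have [v vE] := exists_dresidual psi z 0 (fun l => - residual psi z l).
have d0 : lsubmx (row_mx 0 v) = lsubmx (0 : 'rV[R]_(n + \sum_(j < L) N j)).
  by rewrite row_mxKl raddf0.
have obj_le : dobjective g lambda z (row_mx 0 v) <=
    \sum_(l < L) Kg * \prod_(l.+1 <= j < L) (1 + K j) *
      l1norm (residual psi z l).
  have := dobjective_gap d0; rewrite dobjective0 subr0.
  move=> /(le_trans (ler_norm _))/le_trans; apply.
  by apply: ler_sum => l _; rewrite vE dresidual0 subr0 l1normN.
have pen_ge0 : \sum_(l < L) beta l * l1norm (residual psi z l) <=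
    dobjective g lambda z (row_mx 0 v).
  rewrite -subr_ge0 -sumrN; apply: le_trans (stat (row_mx 0 v)) _.
  by rewrite lerD2l; apply: ler_sum => l _; rewrite vE dl1normN mulrN.
have excess_ge0 l : 0 <= (beta l - Kg * \prod_(l.+1 <= j < L) (1 + K j)) *
    l1norm (residual psi z l).
  by rewrite mulr_ge0 ?l1norm_ge0// subr_ge0 ltW.
have : \sum_(l < L) (beta l - Kg * \prod_(l.+1 <= j < L) (1 + K j)) *
    l1norm (residual psi z l) <= 0.
  under eq_bigr do rewrite mulrBl.
  by rewrite sumrB subr_le0 (le_trans pen_ge0).
move=> excess_le0 l; apply/subr0_eq/l1norm_eq0; rewrite -/(residual psi z l).
have /eqP : \sum_(l < L) (beta l - Kg * \prod_(l.+1 <= j < L) (1 + K j)) *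
    l1norm (residual psi z l) = 0.
  by apply: le_anti; rewrite excess_le0 sumr_ge0.
rewrite psumr_eq0// => /allP/(_ l (mem_index_enum _)).
by rewrite mulf_eq0 subr_eq0 gt_eqF//= => /eqP.
Qed.

(** Every direction is compared with the tangent direction of the same theta
    part; the penalty pays for the difference. *)
Lemma objective_stationary_penalized : feasible psi z ->
  (forall d, tangent_cone (feasible psi) z d -> 0 <= dobjective g lambda z d) ->
  forall d, 0 <= dpenalized g psi lambda beta z d.
Proof.
move=> zF stat d.
have [v vE] := exists_dresidual psi z (lsubmx d) (fun l => 0).
have dd' : lsubmx d = lsubmx (row_mx (lsubmx d) v) by rewrite row_mxKl.
have /stat d'_ge0 : tangent_cone (feasible psi) z (row_mx (lsubmx d) v).
  exact: feasible_tangent.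
have residual0 l : residual psi z l = 0 by rewrite /residual zF subrr.
have gap : \sum_(l < L) Kg * \prod_(l.+1 <= j < L) (1 + K j) *
    l1norm (dresidual psi z d l - dresidual psi z (row_mx (lsubmx d) v) l) <=
    \sum_(l < L) beta l * dl1norm (residual psi z l) (dresidual psi z d l).
  apply: ler_sum => l _; rewrite vE subr0 residual0 dl1norm0.
  by rewrite ler_wpM2r ?l1norm_ge0// ltW.
have := le_trans (dobjective_gap dd') gap; rewrite ler_norml => /andP[+ _].
by rewrite /dpenalized; lra.
Qed.

End ExactPenalty.

(** The two objectives agree on the feasible points that realize the tangent
    direction, so they have the same velocity along them. *)
Lemma tangent_dobjective_dpenalized (R : realType) (n L : nat) (N : nat -> nat)
    (g : 'rV[R]_(\sum_(j < L) N j) -> R)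
    (psi : forall l : 'I_L, 'rV[R]_(n + \sum_(j < l) N j) -> 'rV[R]_(N l))
    (lambda : R) (beta : 'I_L -> R) (z d : 'rV[R]_(n + \sum_(j < L) N j)) :
  dir_differentiable g -> (forall l, dir_differentiable (@psi l)) ->
  locally_lipschitz g -> (forall l, locally_lipschitz (@psi l)) ->
  feasible psi z -> tangent_cone (feasible psi) z d ->
  dobjective g lambda z d = dpenalized g psi lambda beta z d.
Proof.
move=> g_dd psi_dd g_ll psi_ll zF [xs [tau [xsF _ tau_gt0 tau0 xs_vel]]].
have obj : velocity tau (objective g lambda \o xs) (objective g lambda z)
    (dobjective g lambda z d).
  exact: (velocity_objective g_dd g_ll tau_gt0 tau0 xs_vel).
have pen : velocity tau (penalized g psi lambda beta \o xs)
    (penalized g psi lambda beta z) (dpenalized g psi lambda beta z d).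
  exact: (velocity_penalized g_dd psi_dd g_ll psi_ll tau_gt0 tau0 xs_vel).
apply: velocity_unique obj _.
have -> : objective g lambda \o xs = penalized g psi lambda beta \o xs.
  by apply/funext => k /=; rewrite feasible_penalized.
by rewrite -(feasible_penalized g lambda beta zF).
Qed.

Lemma minimizer_dpenalized_ge0 (R : realType) (n L : nat) (N : nat -> nat)
    (g : 'rV[R]_(\sum_(j < L) N j) -> R)
    (psi : forall l : 'I_L, 'rV[R]_(n + \sum_(j < l) N j) -> 'rV[R]_(N l))
    (lambda : R) (beta : 'I_L -> R) (z d : 'rV[R]_(n + \sum_(j < L) N j)) :
  dir_differentiable g -> (forall l, dir_differentiable (@psi l)) ->
  locally_lipschitz g -> (forall l, locally_lipschitz (@psi l)) ->
  minimizers setT (penalized g psi lambda beta) z ->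
  0 <= dpenalized g psi lambda beta z d.
Proof.
move=> g_dd psi_dd g_ll psi_ll [_ z_min].
have tau_gt0 k : 0 < @harmonic R k by exact: harmonic_gt0.
have ray := velocity_ray tau_gt0 z (d := d).
have pen : velocity harmonic
    (penalized g psi lambda beta \o (fun k => z + harmonic k *: d))
    (penalized g psi lambda beta z) (dpenalized g psi lambda beta z d).
  exact: (velocity_penalized g_dd psi_dd g_ll psi_ll tau_gt0 cvg_harmonic ray).
apply: (cvgr_to_ge pen); apply: nearW => k /=.
by apply: mulr_ge0; [rewrite invr_ge0 ltW|rewrite subr_ge0 z_min].
Qed.

(** * Existence of minimizers *)

Lemma continuous_bounded_ball (R : realType) m p (f : 'rV[R]_m -> 'rV[R]_p)
    (M : R) :
  continuous f -> exists B, forall x, `|x| <= M -> `|f x| <= B.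
Proof.
move=> f_cont; pose A := [set x : 'rV[R]_m | `|x| <= M].
have A_compact : compact A.
  apply: bounded_closed_compact.
    exists M; split=> [|M' MM' x Ax]; first exact: num_real.
    exact: le_trans Ax (ltW MM').
  have -> : A = (fun x => `|x|) @^-1` [set t | t <= M] by [].
  by apply: closed_comp => [x _|]; [exact: norm_continuous|exact: closed_le].
have /compact_bounded[B [_ B_bound]] : compact (f @` A).
  by apply: continuous_compact => //; exact: continuous_subspaceT.
exists (B + 1) => x Ax; apply: (B_bound (B + 1)); first by rewrite ltrDl.
by exists x.
Qed.

(** Restriction to blocks and regrouping of coordinates are of this form. *)
Lemma continuous_coordinates (R : realType) m p (f : 'rV[R]_m -> 'rV[R]_p) :
  (forall i, exists j, forall x, f x 0 i = x 0 j) -> continuous f.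
Proof.
move=> fE x; apply: (@cvg_rV _ _ (nbhs x)) => i; have [j fij] := fE i.
by rewrite fij; under eq_fun do rewrite fij; exact: coord_continuous.
Qed.

Section Compactness.
Context (R : realType) (n L : nat) (N : nat -> nat).
Context (g : 'rV[R]_(\sum_(j < L) N j) -> R).
Context (psi : forall l : 'I_L, 'rV[R]_(n + \sum_(j < l) N j) -> 'rV[R]_(N l)).
Context (lambda : R) (lambda_gt0 : 0 < lambda).
Context (beta : 'I_L -> R) (beta_gt0 : forall l, 0 < beta l).
Context (g_ge0 : forall u, 0 <= g u) (g_cont : continuous g).
Context (psi_cont : forall l : 'I_L, continuous (@psi l)).

Implicit Types z : 'rV[R]_(n + \sum_(j < L) N j).

Lemma layer_arg_continuous (l : 'I_L) :
  continuous (fun z : 'rV[R]_(n + \sum_(j < L) N j) => layer_arg z l).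
Proof.
apply: continuous_coordinates => i; rewrite -[i]splitK.
case: (fintype.split i) => t /=.
  by exists (lshift _ t) => z; rewrite row_mxEl mxE.
by eexists => z; rewrite row_mxEr !mxE.
Qed.

Lemma residual_continuous l :
  continuous (fun z : 'rV[R]_(n + \sum_(j < L) N j) => residual psi z l).
Proof.
have block_cont : continuous (fun z : 'rV[R]_(n + \sum_(j < L) N j) =>
    ublock (rsubmx z) l).
  by apply: continuous_coordinates => i; eexists => u; rewrite !mxE.
move=> z; apply: (@cvgB _ _ _ (nbhs z)); first exact: block_cont.
apply: (@continuous_comp _ _ _ (fun w => layer_arg w l) (@psi l) z).
  exact: layer_arg_continuous.
exact: psi_cont.
Qed.

Lemma penalized_continuous : continuous (penalized g psi lambda beta).
Proof.
move=> z; apply: (@cvgD _ _ _ (nbhs z)); first apply: (@cvgD _ _ _ (nbhs z)).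
- apply: (@continuous_cvg _ _ _ (nbhs z) _ (fun w : 'rV[R]_(n + _) => rsubmx w)
    g); first exact: g_cont.
  by apply: continuous_coordinates => i; eexists => u; rewrite mxE.
- apply: (@cvgMl_tmp _ _ (nbhs z)).
  have theta_cvg : enorm (lsubmx w) @[w --> z] --> enorm (lsubmx z).
    apply: (@continuous_cvg _ _ _ (nbhs z) _
      (fun w : 'rV[R]_(n + _) => lsubmx w)
      (@enorm R n)).
      exact: enorm_continuous.
    by apply: continuous_coordinates => i; eexists => u; rewrite mxE.
  exact: (@cvgM _ _ (nbhs z)).
apply: (@cvg_bigsum _ _ (nbhs z)) => l; apply: (@cvgMl_tmp _ _ (nbhs z)).
apply: (@continuous_cvg _ _ _ (nbhs z) _ (residual psi ^~ l) (@l1norm R (N l))).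
  exact: l1norm_continuous.
exact: residual_continuous.
Qed.

Lemma objective_ge0 z : 0 <= objective g lambda z.
Proof. by rewrite addr_ge0// mulr_ge0 ?sqr_ge0// ltW. Qed.

Lemma residual_le_penalized z l :
  beta l * l1norm (residual psi z l) <= penalized g psi lambda beta z.
Proof.
rewrite -[leLHS]add0r; apply: lerD; first exact: objective_ge0.
rewrite (bigD1 l)//= lerDl sumr_ge0// => j _.
by rewrite mulr_ge0 ?l1norm_ge0// ltW.
Qed.

Lemma objective_le_penalized z :
  objective g lambda z <= penalized g psi lambda beta z.
Proof.
by rewrite lerDl sumr_ge0// => l _; rewrite mulr_ge0 ?l1norm_ge0// ltW.
Qed.

(** The quadratic term bounds theta.  Then the layers are bounded one after the
    other: psi l is bounded on the bounded set of its arguments, and the penalty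
    bounds the distance of layer l to psi l. *)
Lemma level_set_bounded gamma : exists M, forall z,
  level_set g psi lambda beta gamma z -> `|z| <= M.
Proof.
(* t <= 1 + t ^ 2 avoids a square root *)
pose Mth := 1 + gamma / lambda.
have theta_le z : level_set g psi lambda beta gamma z -> `|lsubmx z| <= Mth.
  move=> zg; apply: le_trans (norm_le_enorm _) _.
  have : enorm (lsubmx z) ^+ 2 <= gamma / lambda.
    rewrite ler_pdivlMr// mulrC; apply: le_trans zg.
    by apply: le_trans (objective_le_penalized z); rewrite lerDr.
  rewrite /Mth; have := sqr_ge0 (enorm (lsubmx z) - 1).
  have := enorm_ge0 (lsubmx z).
  by nra.
have layers_le k : exists M, forall z, level_set g psi lambda beta gamma z ->
    forall l : 'I_L, (l < k)%N -> `|ublock (rsubmx z) l| <= M.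
  elim: k => [|k [M IH]]; first by exists 0.
  have [kL|Lk] := ltnP k L; last first.
    by exists M => z zg l _; apply: IH; rewrite // (leq_trans (ltn_ord l)).
  pose l := Ordinal kL.
  have [B psi_le] := continuous_bounded_ball (Num.max 0 (Num.max Mth M))
    (@psi_cont l).
  exists (Num.max M (gamma / beta l + B)) => z zg j.
  rewrite ltnS leq_eqVlt => /predU1P[jk|jk]; last first.
    by rewrite le_max (IH z zg).
  have -> : j = l by exact: val_inj.
  rewrite le_max; apply/orP; right.
  rewrite -[ublock _ _](subrK (psi (layer_arg z l))).
  apply: le_trans (ler_normD _ _) _; apply: lerD.
    apply: le_trans (norm_le_enorm _) _; apply: le_trans (enorm_le_l1norm _) _.
    rewrite ler_pdivlMr// mulrC; apply: le_trans zg.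
    exact: residual_le_penalized.
  apply: psi_le; apply: norm_le_coord => [|i]; first by rewrite le_max lexx.
  rewrite !le_max mxE; apply/orP; right; apply/orP.
  case: splitP => t _.
    by left; apply: le_trans (ler_coord_norm _ _) (theta_le _ zg).
  right; rewrite mxE.
  pose j' := widen_ord (ltnW (ltn_ord l)) (tagnat.sig1 t).
  have j'k : (j' < k)%N by exact: (ltn_ord (tagnat.sig1 t)).
  exact: le_trans (ler_coord_norm _ _) (IH z zg j' j'k).
have [M M_le] := layers_le L.
exists (Num.max 0 (Num.max Mth M)) => z zg.
apply: norm_le_coord => [|i]; first by rewrite le_max lexx.
rewrite !le_max -[z]hsubmxK mxE; apply/orP; right; apply/orP.
case: splitP => t _.
  by left; apply: le_trans (ler_coord_norm _ _) (theta_le _ zg).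
right; rewrite -[rsubmx z](submxrowK (rsubmx z)) mxE.
exact: le_trans (ler_coord_norm _ _) (M_le _ zg _ (ltn_ord _)).
Qed.

Lemma penalized_minimizer :
  exists z, minimizers setT (penalized g psi lambda beta) z.
Proof.
pose gamma := penalized g psi lambda beta 0.
pose A := level_set g psi lambda beta gamma.
have [M A_le] := level_set_bounded gamma.
have A_compact : compact A.
  apply: bounded_closed_compact.
    exists M; split=> [|M' MM' x Ax]; first exact: num_real.
    by apply: le_trans (A_le x Ax) (ltW MM').
  have -> : A = penalized g psi lambda beta @^-1` [set t | t <= gamma] by [].
  apply: closed_comp => [x _|]; first exact: penalized_continuous.
  exact: closed_le.
have A0 : A 0 by exact: lexx.
have [||z] := @EVT_min_rV R _ (penalized g psi lambda beta) A _ A_compact.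
- by exists 0.
- exact/continuous_subspaceT/penalized_continuous.
rewrite inE => Az z_min; exists z; split=> // y _.
have [Ay|yA] := pselect (A y); first by apply: z_min; rewrite inE.
apply: le_trans Az _; rewrite leNgt; apply/negP => /ltW.
exact: yA.
Qed.

End Compactness.

(** * Exactness *)

Theorem theorem3p2 (R : realType) (n L : nat) (N : nat -> nat)
    (n_gt0 : (0 < n)%N) (L_gt0 : (0 < L)%N)
    (N_gt0 : forall l : 'I_L, (0 < N l)%N)
    (lambda : R) (lambda_gt0 : 0 < lambda)
    (g : 'rV[R]_(\sum_(j < L) N j) -> R)
    (psi : forall l : 'I_L,
        'rV[R]_(n + \sum_(j < l) N j) -> 'rV[R]_(N l))
    (g_ge0 : forall u, 0 <= g u)
    (g_cont : continuous g)
    (psi_cont : forall l : 'I_L, continuous (psi l))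
    (g_ddiff : dir_differentiable g)
    (psi_ddiff : forall l : 'I_L, dir_differentiable (psi l))
    (g_loclip : locally_lipschitz g)
    (psi_loclip : forall l : 'I_L, locally_lipschitz (psi l))
    (beta : 'I_L -> R) (beta_gt0 : forall l : 'I_L, 0 < beta l)
    (u0 : 'rV[R]_(\sum_(j < L) N j))
    (u0E : forall l : 'I_L, ublock u0 l = psi l (row_mx 0 (uprefix u0 l)))
    (gamma : R) (gammaE : gamma = penalized g psi lambda beta (row_mx 0 u0))
    (Kg : R) (Kg_gt0 : 0 < Kg)
    (K : nat -> R) (K_gt0 : forall l : nat, (0 < l < L)%N -> 0 < K l)
    (eps : R) (eps_gt0 : 0 < eps)
    (g_lip : forall (theta : 'rV[R]_n) (u v : 'rV[R]_(\sum_(j < L) N j)),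
        fatten (level_set g psi lambda beta gamma) eps (row_mx theta u) ->
        fatten (level_set g psi lambda beta gamma) eps (row_mx theta v) ->
        `|g u - g v| <= Kg * enorm (u - v))
    (psi_lip : forall (l : 'I_L) (theta : 'rV[R]_n)
          (u v : 'rV[R]_(\sum_(j < L) N j)),
        (0 < l)%N ->
        fatten (level_set g psi lambda beta gamma) eps (row_mx theta u) ->
        fatten (level_set g psi lambda beta gamma) eps (row_mx theta v) ->
        enorm (psi l (row_mx theta (uprefix u l)) -
               psi l (row_mx theta (uprefix v l))) <=
          K l * enorm (uprefix u l - uprefix v l))
    (beta_large : forall l : 'I_L,
        Kg * \prod_(l.+1 <= j < L) (1 + K j) < beta l) :
  minimizers (feasible psi) (objective g lambda) =
    minimizers setT (penalized g psi lambda beta) /\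
  (forall z : 'rV[R]_(n + \sum_(j < L) N j),
      penalized g psi lambda beta z <= gamma ->
      (dstat0 g psi lambda z <-> dstat1 g psi lambda beta z)).
Proof.
have K_ge0 l : (0 < l < L)%N -> 0 <= K l by move=> /K_gt0/ltW.
have near_level z : penalized g psi lambda beta z <= gamma ->
    nbhs z (fatten (level_set g psi lambda beta gamma) eps).
  exact: fatten_nbhs.
have stationary_feasible z : penalized g psi lambda beta z <= gamma ->
    (forall d, 0 <= dpenalized g psi lambda beta z d) -> feasible psi z.
  move=> /near_level z_int; exact: (dpenalized_ge0_feasible g_ddiff psi_ddiff
    g_loclip psi_loclip (ltW Kg_gt0) K_ge0 g_lip psi_lip beta_large z_int).
have penalizedE z := @feasible_penalized R n L N g psi lambda beta z.
have S1_feasible z : minimizers setT (penalized g psi lambda beta) z ->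
    feasible psi z.
  move=> z_min; apply: stationary_feasible => [|d].
    by rewrite gammaE; exact: z_min.2.
  exact: minimizer_dpenalized_ge0.
split.
  apply/seteqP; split=> z.
    move=> [zF z_min]; split=> // y _.
    have [w w_min] := penalized_minimizer lambda_gt0 beta_gt0 g_ge0 g_cont
      psi_cont.
    have wF := S1_feasible w w_min.
    apply: le_trans (w_min.2 y I); rewrite !penalizedE//.
    exact: z_min.
  move=> z_min; have zF := S1_feasible z z_min; split=> // y yF.
  by rewrite -!penalizedE//; exact: z_min.2.
move=> z z_level; split.
  move=> [zF z_stat] d; rewrite dir_deriv_penalized//.
  apply: (objective_stationary_penalized g_ddiff psi_ddiff g_loclip psi_loclip
    (ltW Kg_gt0) K_ge0 g_lip psi_lip beta_large (near_level z z_level)) => // e.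
  by move=> /z_stat; rewrite dir_deriv_objective.
move=> z_stat; have pen_ge0 d : 0 <= dpenalized g psi lambda beta z d.
  by rewrite -dir_deriv_penalized.
have zF := stationary_feasible z z_level pen_ge0.
split=> // d dT; rewrite dir_deriv_objective//.
by rewrite (tangent_dobjective_dpenalized _ beta g_ddiff psi_ddiff _ _ zF dT).
Qed.
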